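(* Let $A$ be a completely positive matrix of size $n\times n$. Then $\tau_{\mathrm{cp}}^{\mathrm{sos}}(A)\ge\operatorname{rank}(A)$.
   Context: A real symmetric $n\times n$ matrix $A$ is completely positive if $A=\sum_{i=1}^r a_ia_i^T$ for some $r$ and some entrywise nonnegative vectors $a_i\in\mathbb R^n$. $\operatorname{rank}(A)$ is the ordinary matrix rank. $\operatorname{vec}(A)\in\mathbb R^{n^2}$ is obtained by stacking the columns of $A$; coordinates of $\mathbb R^{n^2}$, and rows and columns of real symmetric $n^2\times n^2$ matrices, are indexed by pairs $ij$ with $1\le i,j\le n$, where $ij$ corresponds to position $(j-1)n+i$ (so $\operatorname{vec}(A)_{ij}=A_{ij}$). $A\otimes A$ is the Kronecker product, and $X\preceq Y$ means $Y-X$ is positive semidefinite. $\tau_{\mathrm{cp}}^{\mathrm{sos}}(A)$ is the optimal value of the semidefinite program: minimize $t$ over $t\in\mathbb R$ and real symmetric $n^2\times n^2$ matrices $X$ subject to $$\begin{bmatrix}t&\operatorname{vec}(A)^T\\ \operatorname{vec}(A)&X\end{bmatrix}\succeq 0,\quad X_{ij,ij}\le A_{ij}^2\ \ \forall i,j,\quad X\preceq A\otimes A,\quad X_{ij,kl}=X_{il,kj}\ \ \text{for all }1\le i<k\le n,\ 1\le j<l\le n.$$ *)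

(* Defs.v *)
From HB Require Import structures.
From mathcomp Require Import all_boot all_order all_algebra.
From mathcomp Require Import classical_sets reals constructive_ereal ereal.
From mathcomp Require Import mxtens.

Set Implicit Arguments.
Unset Strict Implicit.
Unset Printing Implicit Defensive.

Import Order.TTheory GRing.Theory Num.Theory.
Local Open Scope classical_set_scope.
Local Open Scope ring_scope.

Definition completely_positive (R : realType) (n : nat) (A : 'M[R]_n) : Prop :=
  exists (r : nat) (a : 'I_r -> 'cV[R]_n),
    (forall i j, 0 <= a i j 0) /\ A = \sum_i a i *m (a i)^T.

Definition psdmx (R : realType) (m : nat) (M : 'M[R]_m) : Prop :=
  M^T = M /\ forall x : 'cV[R]_m, 0 <= (x^T *m M *m x) 0 0.

Definition loewner_le (R : realType) (m : nat) (X Y : 'M[R]_m) : Prop :=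
  psdmx (Y - X).

(* Column stacking: the 0-based value of [vidx i j] is j * n + i, hence the swap
   with respect to the row-major [mxtens_index]. *)
Definition vidx (n : nat) (i j : 'I_n) : 'I_(n * n) := mxtens_index (j, i).

Definition vec (R : realType) (n : nat) (A : 'M[R]_n) : 'cV[R]_(n * n) :=
  \col_p A (mxtens_unindex p).2 (mxtens_unindex p).1.

Lemma vidxE (n : nat) (i j : 'I_n) : vidx i j = (j * n + i)%N :> nat.
Proof. by []. Qed.

Lemma vecE (R : realType) (n : nat) (A : 'M[R]_n) (i j : 'I_n) (k : 'I_1) :
  vec A (vidx i j) k = A i j.
Proof. by rewrite mxE mxtens_indexK. Qed.

Definition tau_cp_sos_feasible (R : realType) (n : nat) (A : 'M[R]_n)
    (t : R) (X : 'M[R]_(n * n)) : Prop :=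
  [/\ X^T = X,
      psdmx (block_mx (t%:M : 'M[R]_1) (vec A)^T (vec A) X),
      forall i j : 'I_n, X (vidx i j) (vidx i j) <= A i j ^+ 2,
      loewner_le X (A *t A)
    & forall i j k l : 'I_n, (i < k)%N -> (j < l)%N ->
        X (vidx i j) (vidx k l) = X (vidx i l) (vidx k j)].

(* The optimal value is an extended real: +oo when the program is infeasible. *)
Definition tau_cp_sos (R : realType) (n : nat) (A : 'M[R]_n) : \bar R :=
  ereal_inf [set t%:E | t in
    [set t : R | exists X : 'M[R]_(n * n), tau_cp_sos_feasible A t X]].

(* Main.v *)
Require Import Defs.
From mathcomp Require Import all_boot all_order all_algebra.
From mathcomp Require Import reals constructive_ereal.
From mathcomp Require Import ereal mxtens lra.

Import Order.TTheory GRing.Theory Num.Theory.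

Local Open Scope ring_scope.

(** For a symmetric matrix [A] with symmetric generalized inverse [W]
    ([A W A = A]), [W A] is idempotent with trace [rank A]. Hence, writing
    [w = vec W] and [r = rank A], both [<w, vec A>] and [w^T (A (x) A) w] equal
    [r]. Testing the semidefinite constraint against [(1, -w)] and using
    [X <= A (x) A] gives [0 <= t - 2 r + w^T X w <= t - r]. *)

(** Take a rank factorization [A = C R]. Cancelling [C] on the left and [R] on the right in
    [C R W C R = C R] leaves [R W C = 1], an identity of size [\rank A], and by cyclicity its trace
    is that of [W A]. *)
Lemma mxtrace_ginv (F : fieldType) (m n : nat) (A : 'M[F]_(m, n))
    (W : 'M[F]_(n, m)) :
  A *m W *m A = A -> \tr (W *m A) = (\rank A)%:R.
Proof.
move: (row_base_free A) (col_base_full A) (mulmx_base A).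
move: (col_base A) (row_base A) => C R freeR fullC CR AWA.
rewrite -[in LHS]CR mulmxA mxtrace_mulC.
suff -> : R *m (W *m C) = 1%:M by rewrite mxtrace1.
apply: (row_free_inj freeR); apply: (row_full_inj fullC).
by rewrite mul1mx !mulmxA CR -mulmxA CR.
Qed.

(** Transposing [A V A = A] shows that [V^T] is a generalized inverse too, and so is the average of
    [V] and [V^T]. *)
Lemma sym_ginv (F : fieldType) (n : nat) (A : 'M[F]_n) :
  (2%:R : F) != 0 -> A^T = A ->
  exists2 W : 'M[F]_n, W^T = W & A *m W *m A = A.
Proof.
move=> nz2 symA.
have [V AVA] : exists V, A *m V *m A = A by exists (pinvmx A); rewrite mulmxKpV.
have AVtA : A *m V^T *m A = A.
  by rewrite -[RHS]symA -[in RHS]AVA !trmx_mul symA mulmxA.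
exists (2%:R^-1 *: (V + V^T)); first by rewrite linearZ linearD /= trmxK addrC.
rewrite -scalemxAr -scalemxAl mulmxDr mulmxDl AVA AVtA -mulr2n -scaler_nat.
by rewrite scalerA mulVf // scale1r.
Qed.

Lemma sum_mxtens_index (V : nmodType) (m n : nat) (F : 'I_m -> 'I_n -> V) :
  \sum_(p < m * n) F (mxtens_unindex p).1 (mxtens_unindex p).2
  = \sum_i \sum_j F i j.
Proof.
rewrite pair_big (reindex (@mxtens_index m n)); last first.
  by exists (@mxtens_unindex m n) => p _; rewrite ?mxtens_indexK ?mxtens_unindexK.
by apply: eq_bigr => -[i j] _; rewrite mxtens_indexK.
Qed.

Lemma vec_dot (R : realType) (n : nat) (U V : 'M[R]_n) :
  ((vec U)^T *m vec V) 0 0 = \tr (U^T *m V).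
Proof.
rewrite mxE /mxtrace; under [RHS]eq_bigr do rewrite mxE.
rewrite -(sum_mxtens_index _ _ _ (fun i j => U^T i j * V j i)).
by apply: eq_bigr => p _; rewrite !mxE.
Qed.

(** Column stacking makes the column index the first of the pair, so the left factor [A] acts on the
    columns of [W] and [B] on its rows. *)
Lemma tens_vec (R : realType) (n : nat) (A B W : 'M[R]_n) :
  (A *t B) *m vec W = vec (B *m W *m A^T).
Proof.
apply/colP => p; rewrite !mxE.
under [RHS]eq_bigr do rewrite !mxE mulr_suml.
rewrite -(sum_mxtens_index _ _ _ (fun i j =>
  B (mxtens_unindex p).2 j * W j i * A (mxtens_unindex p).1 i)).
by apply: eq_bigr => q _; rewrite !mxE -mulrA mulrC.
Qed.

Lemma completely_positive_sym (R : realType) (n : nat) (A : 'M[R]_n) :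
  completely_positive A -> A^T = A.
Proof.
case=> r [a [_ ->]]; rewrite linear_sum /=.
by apply: eq_bigr => i _; rewrite trmx_mul trmxK.
Qed.

Lemma rank_le_feasible (R : realType) (n : nat) (A : 'M[R]_n)
    (t : R) (X : 'M[R]_(n * n)) :
  A^T = A -> psdmx (block_mx (t%:M : 'M[R]_1) (vec A)^T (vec A) X) ->
  loewner_le X (A *t A) -> (\rank A)%:R <= t.
Proof.
move=> symA [_ psdB] [_ leX].
have [W symW AWA] := sym_ginv _ _ A (lt0r_neq0 (ltr0Sn R 1)) symA.
have tr_WA := mxtrace_ginv _ _ _ _ _ AWA.
set w := vec W.
have wA : (w^T *m vec A) 0 0 = (\rank A)%:R by rewrite vec_dot symW.
have Aw : ((vec A)^T *m w) 0 0 = (\rank A)%:R by rewrite vec_dot symA mxtrace_mulC.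
(* The form equals the trace of [W (A W A)], which collapses to that of [W A]. *)
have wAAw : (w^T *m (A *t A) *m w) 0 0 = (\rank A)%:R.
  by rewrite -mulmxA tens_vec vec_dot symW symA AWA.
have subE (U V : 'M[R]_1) : (U - V) 0 0 = U 0 0 - V 0 0 by rewrite !mxE.
have := leX w; rewrite mulmxBr mulmxBl subE wAAw => le_wXw.
have := psdB (col_mx 1%:M (- w)).
rewrite tr_col_mx mul_row_block mul_row_col trmx1 !mul1mx mulmx1.
rewrite linearN /= !(mulNmx, mulmxN) mulmxDl !mulNmx.
rewrite !subE wA Aw [_%:M _ _]mxE mulr1n; lra.
Qed.

Theorem theorem8 (R : realType) (n : nat) (A : 'M[R]_n)
    (hA : completely_positive A) :
  ((\rank A)%:R%:E <= tau_cp_sos A)%E.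
Proof.
(* It suffices to bound each feasible [t]; an infeasible program has value [+oo]. *)
apply: le_ereal_inf_tmp => _ [t [X [_ psdB _ leX _]] <-]; rewrite lee_fin.
exact: rank_le_feasible (completely_positive_sym _ _ _ hA) psdB leX.
Qed.
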